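(* Let $G$ be a finite simple graph and $e \in E(G)$. Then $\gamma_{gr}^L(G) - 1 \leq \gamma_{gr}^L(G - e) \leq \gamma_{gr}^L(G) + 2$, where $G - e$ is the graph obtained from $G$ by deleting the edge $e$.
   Context: For a vertex $v$, $N(v)$ is its open neighborhood (the set of its neighbors) and $N[v] = N(v) \cup \{v\}$ its closed neighborhood. An L-sequence of a graph $G$ is a sequence $(v_1, \ldots, v_k)$ of distinct vertices of $G$ such that for every $i \in \{1,\ldots,k\}$, $N[v_i] \setminus \bigcup_{j=1}^{i-1} N(v_j) \neq \emptyset$. The L-Grundy domination number $\gamma_{gr}^L(G)$ is the maximum length of an L-sequence of $G$. *)

(* Defs.v *)
From mathcomp Require Import all_boot.

Set Implicit Arguments.
Unset Strict Implicit.
Unset Printing Implicit Defensive.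

Record sgraph := SGraph {
  vertex :> finType;
  adj : rel vertex;
  adj_sym : symmetric adj;
  adj_irr : irreflexive adj }.

(* An edge is the unordered pair [set x; y] of its ends. *)
Definition edges (G : sgraph) : {set {set G}} :=
  [set A : {set G} | [exists x, exists y, adj x y && (A == [set x; y])]].

Section DeleteEdge.
Variables (G : sgraph) (e : {set G}).

Definition del_edge_rel : rel G :=
  fun x y => adj x y && ([set x; y] != e).

Lemma del_edge_sym : symmetric del_edge_rel.
Proof. by move=> x y; rewrite /del_edge_rel adj_sym setUC. Qed.

Lemma del_edge_irr : irreflexive del_edge_rel.
Proof. by move=> x; rewrite /del_edge_rel adj_irr. Qed.

Definition del_edge : sgraph := SGraph del_edge_sym del_edge_irr.

End DeleteEdge.

Definition open_nbh (G : sgraph) (v : G) : {set G} := [set u | adj v u].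

Definition closed_nbh (G : sgraph) (v : G) : {set G} := v |: open_nbh v.

Definition L_sequence (G : sgraph) (k : nat) (s : k.-tuple G) : bool :=
  uniq s &&
  [forall i : 'I_k,
     closed_nbh (tnth s i)
       :\: \bigcup_(j : 'I_k | j < i) open_nbh (tnth s j) != set0].

(* Entries are distinct, so lengths are at most #|G|; the empty sequence
   makes the maximum range over a nonempty set. *)
Definition L_grundy (G : sgraph) : nat :=
  \max_(k < #|G|.+1 | [exists s : k.-tuple G, L_sequence s]) k.

Lemma L_sequence_le_grundy (G : sgraph) (k : nat) (s : k.-tuple G) :
  L_sequence s -> k <= L_grundy G.
Proof.
move=> Ls; have ltk : k < #|G|.+1.
  have /andP[us _] := Ls.
  by rewrite ltnS -(size_tuple s) -(card_uniqP us) max_card.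
apply: (leq_bigmax_cond (F := fun i : 'I_#|G|.+1 => i : nat) (Ordinal ltk)).
by apply/existsP; exists s.
Qed.

Lemma L_grundy_attained (G : sgraph) :
  exists s : (L_grundy G).-tuple G, L_sequence s.
Proof.
have P0 : [exists s : 0.-tuple G, L_sequence s].
  apply/existsP; exists [tuple]; rewrite /L_sequence /=.
  by apply/forallP => -[].
have ne : 0 < #|[pred k : 'I_#|G|.+1 | [exists s : k.-tuple G, L_sequence s]]|.
  by apply/card_gt0P; exists ord0.
have [k Pk ek] := eq_bigmax_cond (fun i : 'I_#|G|.+1 => i : nat) ne.
by move: Pk; rewrite /L_grundy ek => /existsP.
Qed.

(* Main.v *)
Require Import Defs.
From mathcomp Require Import all_boot.

Set Implicit Arguments.
Unset Strict Implicit.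
Unset Printing Implicit Defensive.

(** Record with an L-sequence a map [f] choosing for each entry [v] a vertex
    [f v] of [N[v]] that no earlier entry is adjacent to; [f] still serves every
    subsequence. Let [e = xy]. Dropping [x] and [y] from a sequence of [G - e]
    leaves a sequence of [G], since the other neighborhoods agree. Conversely,
    in a sequence of [G] the choice [f v] is lost in [G - e] only if
    [{v, f v} = e]. Suppose that [y] does not precede [x]. Unless [y] is an
    entry with [f y = x], only the choice at [x] can be lost. If [f y = x], then
    no entry before [y], hence none before [x], is adjacent to [x]; so [x] may
    choose itself, and only the choice at [y] is lost. *)

Lemma index_tnth (T : eqType) (k : nat) (s : k.-tuple T) (i : 'I_k) :
  uniq s -> index (tnth s i) s = i.
Proof. by move=> us; rewrite (tnth_nth (tnth s i)) index_uniq ?size_tuple. Qed.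

Lemma pairwise_indexP (T : eqType) (r : rel T) (s : seq T) : uniq s ->
  reflect {in s &, forall x y, index x s < index y s -> r x y} (pairwise r s).
Proof.
case: s => [|x0 s] us; first exact: ReflectT.
apply: (iffP (pairwiseP x0)) => [rs x y xs ys lt_xy | rs i j lti ltj lt_ij].
  by rewrite -(nth_index x0 xs) -(nth_index x0 ys) rs // inE index_mem.
by apply: rs; rewrite ?mem_nth // !index_uniq.
Qed.

Lemma count_set2_eq_le1 (T : finType) (f : T -> T) (s : seq T) (x y : T) :
    x != y -> uniq s -> (x \in s -> f x != y) ->
  count (fun v => [set v; f v] == [set x; y]) s <= 1.
Proof.
move=> xy us fxy; apply: leq_trans (_ : count_mem y s <= 1); last first.
  by rewrite count_uniq_mem ?leq_b1.
rewrite -!size_filter; apply: uniq_leq_size (filter_uniq _ us) _ => v.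
rewrite !mem_filter => /andP[/eqP/setP vE vs]; rewrite vs andbT.
have: v \in [set x; y] by rewrite -vE set21.
rewrite !inE => /orP[/eqP vx|//].
have := vE y; rewrite !inE eqxx orbT vx eq_sym (negPf xy) eq_sym.
by rewrite (negPf (fxy _)) // -vx.
Qed.

Section Footprinting.
Variable T : eqType.
Implicit Types (r : rel T) (f : T -> T) (s : seq T).

Definition footprinting r f s : bool :=
  [&& uniq s, all (fun v => (f v == v) || r v (f v)) s
    & pairwise (fun w v => ~~ r w (f v)) s].

Lemma footprintingP r f s :
  reflect [/\ uniq s, {in s, forall v, (f v == v) || r v (f v)}
            & {in s &, forall w v, index w s < index v s -> ~~ r w (f v)}]
          (footprinting r f s).
Proof.
apply: (iffP and3P) => -[us /allP closed_s open_s]; split=> //.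
  exact/pairwise_indexP.
exact/pairwise_indexP.
Qed.

Lemma footprinting_subseq r f s t :
  subseq t s -> footprinting r f s -> footprinting r f t.
Proof.
move=> sub_ts /and3P[us closed_s open_s]; apply/and3P; split.
- exact: subseq_uniq us.
- exact/allP/(sub_in1 (mem_subseq sub_ts))/allP.
- exact: subseq_pairwise open_s.
Qed.

Lemma footprinting_change_rel r r' f s :
  {in s, forall v, r v (f v) -> r' v (f v)} ->
  {in s &, forall w v, r' w (f v) -> r w (f v)} ->
  footprinting r f s -> footprinting r' f s.
Proof.
move=> sub_rr' sub_r'r /footprintingP[us closed_s open_s].
apply/footprintingP; split=> // [v vs | w v ws vs lt_wv].
  by case/orP: (closed_s v vs) => [-> // | /sub_rr'->]; rewrite ?orbT.
exact: contra (sub_r'r _ _ ws vs) (open_s _ _ ws vs lt_wv).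
Qed.

Lemma footprinting_with r f s v u :
  (u == v) || r v u -> {in s, forall w, index w s < index v s -> ~~ r w u} ->
  footprinting r f s -> footprinting r [eta f with v |-> u] s.
Proof.
move=> closed_u open_u /footprintingP[us closed_s open_s].
apply/footprintingP; split=> // [z zs | w z ws zs] /=.
  by have [->|_] := eqVneq z v; last exact: closed_s.
by have [->|_] := eqVneq z v; [exact: open_u | exact: open_s].
Qed.

End Footprinting.

Section LGrundyFootprinting.
Variable G : sgraph.

Lemma L_sequenceP (k : nat) (s : k.-tuple G) :
  reflect (exists f, footprinting (@adj G) f s) (L_sequence s).
Proof.
apply: (iffP andP) => [[us /forallP Ls] | [f /footprintingP[]]].
- have /fin_all_exists[f fP] (v : G) : exists u, v \in s ->
      ((u == v) || adj v u) /\
      {in s, forall w, index w s < index v s -> ~~ adj w u}.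
    have [/tnthP[i ->]|_] := boolP (v \in s); last by exists v.
    have /set0Pn[u] := Ls i; rewrite !inE => /andP[/bigcupP open_u closed_u].
    exists u => _; split=> // _ /tnthP[j ->]; rewrite !index_tnth // => lt_ji.
    by apply/negP=> adj_ju; apply: open_u; exists j; rewrite ?inE.
  exists f; apply/footprintingP.
  by split=> // [v /fP[] | w v ws /fP[_]]; last exact.
- move=> us closed_s open_s; split=> //.
  apply/forallP=> i; apply/set0Pn; exists (f (tnth s i)).
  rewrite !inE closed_s ?mem_tnth // andbT; apply/bigcupP=> -[j lt_ji].
  by rewrite inE; apply/negP; apply: open_s; rewrite ?mem_tnth ?index_tnth.
Qed.

Lemma size_footprinting_le f (s : seq G) :
  footprinting (@adj G) f s -> size s <= L_grundy G.
Proof.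
move=> fs; apply: (@L_sequence_le_grundy _ _ (in_tuple s)).
by apply/L_sequenceP; exists f.
Qed.

Lemma size_footprinting_le_count (r : rel G) f (bad : pred G) s :
  {in predC bad, forall v, r v (f v) -> adj v (f v)} ->
  {in predC bad, forall w v, adj w (f v) -> r w (f v)} ->
  footprinting r f s -> size s <= L_grundy G + count bad s.
Proof.
move=> sub_r sub_adj fs; rewrite -(count_predC bad) addnC leq_add2r.
rewrite -size_filter; apply: (@size_footprinting_le f).
apply: footprinting_change_rel (footprinting_subseq (filter_subseq _ s) fs).
  by move=> v; rewrite mem_filter => /andP[/sub_r].
by move=> w v; rewrite mem_filter => /andP[/sub_adj + _] _; apply.
Qed.

Lemma L_grundy_footprinting :
  exists f, exists2 s : seq G, footprinting (@adj G) f s & size s = L_grundy G.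
Proof.
have [s /L_sequenceP[f fs]] := L_grundy_attained G.
by exists f, s; rewrite ?size_tuple.
Qed.

End LGrundyFootprinting.

Section EdgeDeletion.
Variable G : sgraph.
Implicit Types (e : {set G}) (f : G -> G) (s : seq G).

Lemma size_footprinting_le_del_edge e f s : footprinting (@adj G) f s ->
  size s <= L_grundy (del_edge e) + count (fun v => [set v; f v] == e) s.
Proof.
apply: (@size_footprinting_le_count (del_edge e)) => [v keeps_v adj_v | w _ v].
  exact/andP.
by case/andP.
Qed.

Lemma size_del_edge_footprinting_le e f s :
  footprinting (del_edge_rel e) f s -> size s <= L_grundy G + count [in e] s.
Proof.
apply: size_footprinting_le_count => [v _ /andP[]// | w we v adj_w].
by rewrite /del_edge_rel adj_w; apply: contraNneq we => <-; rewrite /= set21.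
Qed.

Lemma L_grundy_del_edge_le e : L_grundy (del_edge e) <= L_grundy G + #|e|.
Proof.
have [f [s fs <-]] := L_grundy_footprinting (del_edge e).
have /footprintingP[us _ _] := fs.
have le_count : count [in e] s <= #|e|.
  rewrite -size_filter -(card_uniqP (filter_uniq _ us)).
  by apply/subset_leq_card/subsetP=> v; rewrite mem_filter => /andP[].
by apply: leq_trans (size_del_edge_footprinting_le fs) _; rewrite leq_add2l.
Qed.

Lemma L_grundy_del_edge_ge (x y : G) :
  x != y -> L_grundy G - 1 <= L_grundy (del_edge [set x; y]).
Proof.
have [f [s fs <-]] := L_grundy_footprinting G.
have /footprintingP[us _ open_s] := fs.
wlog le_xy : x y / index x s <= index y s => [IH xy|xy].
  case/orP: (leq_total (index x s) (index y s)) => /IH; first exact.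
  by rewrite setUC eq_sym; apply.
suff [g gs le1] : exists2 g, footprinting (@adj G) g s
    & count (fun v => [set v; g v] == [set x; y]) s <= 1.
  have := size_footprinting_le_del_edge [set x; y] gs.
  by rewrite leq_subLR addnC => /leq_trans; apply; rewrite leq_add2r.
have [/andP[ys /eqP fyx]|] := boolP ((y \in s) && (f y == x)); last first.
  rewrite negb_and -implybE => /implyP fyx; exists f => //.
  by rewrite setUC count_set2_eq_le1 // eq_sym.
exists [eta f with x |-> x]; last by rewrite count_set2_eq_le1 //= eqxx.
apply: footprinting_with fs; first by rewrite eqxx.
by move=> w ws lt_wx; rewrite -fyx open_s ?(leq_trans lt_wx).
Qed.

End EdgeDeletion.

Theorem theorem4p1 (G : sgraph) (e : {set G}) (he : e \in edges G) :
  L_grundy G - 1 <= L_grundy (del_edge e) <= L_grundy G + 2.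
Proof.
move: he; rewrite inE => /existsP[x /existsP[y /andP[axy /eqP ->]]].
have xy : x != y by apply: contraTneq axy => ->; rewrite adj_irr.
rewrite L_grundy_del_edge_ge //=; apply: leq_trans (L_grundy_del_edge_le _) _.
by rewrite cards2 xy.
Qed.
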